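(* For all integers $n\geq 3$ and $m\geq 3$, $$\hom(K_n, K_m^1)=\begin{cases} 0, & \text{if } n\geq m,\\ (m-1)!\cdot 2, & \text{if } n=m-1,\\ n!\binom{m-2}{n-1}\cdot 2+\binom{m-2}{n}\,n!, & \text{if } n\leq m-2.\end{cases}$$ In particular, $\hom(K_n,K_m^1)=\operatorname{inj}(K_n,K_m^1)$ and $\operatorname{sur}(K_n,K_m^1)=\operatorname{bij}(K_n,K_m^1)=0$ for all $n\leq m-1$.
   Context: Graphs are finite and simple: a finite set $V(G)$ of vertices with a set $E(G)$ of unordered pairs of distinct vertices (edges). A homomorphism from $G$ to $H$ is a map $f:V(G)\to V(H)$ such that $f(i)f(j)\in E(H)$ whenever $ij\in E(G)$. $\hom(G,H)$ denotes the number of homomorphisms from $G$ to $H$; $\operatorname{bij}(G,H)$, $\operatorname{sur}(G,H)$, $\operatorname{inj}(G,H)$ denote respectively the numbers of those homomorphisms that are bijective, surjective, injective (as maps on vertices). $K_m$ is the complete graph on $m$ vertices; the quasi-complete graph $K_m^1$ ($m\geq 3$) is the graph obtained from $K_m$ by removing one edge. *)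

(* Defs.v *)
From mathcomp Require Import all_boot.
Set Implicit Arguments.
Unset Strict Implicit.
Unset Printing Implicit Defensive.

Record sgraph := SGraph {
  vertex :> finType;
  edge : rel vertex;
  edge_sym : symmetric edge;
  edge_irrefl : irreflexive edge
}.

Section Hom.
Variables G H : sgraph.

Definition is_hom (f : {ffun G -> H}) : bool :=
  [forall i, forall j, edge i j ==> edge (f i) (f j)].

Definition surjectiveb (f : {ffun G -> H}) : bool :=
  [forall y, exists x, f x == y].

Definition hom : nat := #|[set f | is_hom f]|.
Definition inj : nat := #|[set f | is_hom f & injectiveb f]|.
Definition sur : nat := #|[set f | is_hom f & surjectiveb f]|.
Definition bij : nat := #|[set f | is_hom f & injectiveb f && surjectiveb f]|.

End Hom.

Definition complete_edge n : rel 'I_n := [rel x y | x != y].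

Lemma complete_edge_sym n : symmetric (@complete_edge n).
Proof. by move=> x y; rewrite /complete_edge /= eq_sym. Qed.

Lemma complete_edge_irrefl n : irreflexive (@complete_edge n).
Proof. by move=> x; rewrite /complete_edge /= eqxx. Qed.

Definition complete n : sgraph :=
  SGraph (@complete_edge_sym n) (@complete_edge_irrefl n).

Section RemoveEdge.
Variables (G : sgraph) (u v : G).

Definition remove_edge_rel : rel G :=
  [rel x y | edge x y && ([set x; y] != [set u; v])].

Lemma remove_edge_sym : symmetric remove_edge_rel.
Proof. by move=> x y; rewrite /remove_edge_rel /= edge_sym (setUC [set x]). Qed.

Lemma remove_edge_irrefl : irreflexive remove_edge_rel.
Proof. by move=> x; rewrite /remove_edge_rel /= edge_irrefl. Qed.

Definition remove_edge : sgraph := SGraph remove_edge_sym remove_edge_irrefl.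

End RemoveEdge.

(* The quasi-complete graph K_m^1.  It does not depend on the removed edge uv
   up to isomorphism; the edge is kept as a parameter, and uv is an edge of
   K_m exactly when u != v (for u = v nothing would be removed). *)
Definition quasi_complete m (u v : complete m) : sgraph := remove_edge u v.

(* Main.v *)
Require Import Defs.
From mathcomp Require Import all_boot zify.

(* Two distinct vertices of the complete graph are always adjacent, so a
   homomorphism into the quasi-complete graph is exactly an injection whose
   image misses an endpoint of the removed edge.  Inclusion-exclusion on the
   missed endpoint counts 2 (m-1)^_n - (m-2)^_n of them; Pascal's rule on
   'C(m-1, n) turns this into one binomial formula for all n > 0. *)

Section HomCompleteQuasiComplete.
Variables (n m : nat) (u v : 'I_m).
Hypothesis uv : u != v.

Let homs := [set f | @is_hom (complete n) (@quasi_complete m u v) f].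

(** Phrased with [ffun_on] so that [card_inj_ffuns_on] gives its size as a falling factorial. *)
Let injs (R : {set 'I_m}) : {set {ffun 'I_n -> 'I_m}} :=
  [set f in ffun_on (mem R) | injectiveb f].

(** If [u] and [v] were both hit, their preimages would be distinct since [u != v], hence adjacent,
    yet sent to the removed pair. Conversely, an edge sent to that pair puts both endpoints in the
    image. *)
Lemma is_hom_quasi_complete (f : {ffun 'I_n -> 'I_m}) :
  @is_hom (complete n) (@quasi_complete m u v) f =
  injectiveb f && ((u \notin codom f) || (v \notin codom f)).
Proof.
rewrite -negb_and.
apply/idP/andP => [/forallP homf | [/injectiveP injf missf]].
  have {}homf i j : i != j -> f i != f j /\ [set f i; f j] != [set u; v].
    by move=> ij; move/forallP/(_ j)/implyP/(_ ij)/andP: (homf i).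
  split; first by apply/injectiveP => i j; have [//|/homf[/eqP]] := eqVneq i j.
  apply/negP => /andP[/codomP[i ui] /codomP[j vj]].
  have [ij|/homf[_]] := eqVneq i j; last by rewrite -ui -vj eqxx.
  by move: uv; rewrite ui vj ij eqxx.
apply/forallP => i; apply/forallP => j; apply/implyP => /= ij.
apply/andP; split; first by apply: contra ij => /eqP/injf->.
apply: contra missf => /eqP fij.
have codomE x : x \in [set u; v] -> x \in codom f.
  by rewrite -fij !inE => /orP[] /eqP->; apply: codom_f.
by rewrite !codomE // !inE eqxx ?orbT.
Qed.

Lemma ffun_on_setC1 (f : {ffun 'I_n -> 'I_m}) x :
  (f \in ffun_on (mem [set~ x])) = (x \notin codom f).
Proof.
apply/ffun_onP/idP => [missx | xNf i].
  by apply/codomP => -[i xfi]; have := missx i; rewrite !inE -xfi eqxx.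
by rewrite !inE; apply: contraNneq xNf => <-; apply: codom_f.
Qed.

Lemma homs_quasi_complete : homs = injs [set~ u] :|: injs [set~ v].
Proof.
apply/setP => f; rewrite in_set is_hom_quasi_complete in_setU.
rewrite 2!in_set !ffun_on_setC1.
by rewrite -andb_orl andbC.
Qed.

Lemma injs_setI : injs [set~ u] :&: injs [set~ v] = injs (~: [set u; v]).
Proof.
apply/setP => f; rewrite in_setI 3!in_set andbACA andbb; congr (_ && _).
apply/andP/ffun_onP => [[/ffun_onP fu /ffun_onP fv] i | fuv].
  by have:= fu i; have:= fv i; rewrite !inE negb_or => -> ->.
by split; apply/ffun_onP => i; have:= fuv i; rewrite !inE negb_or => /andP[].
Qed.

Lemma card_injs (R : {set 'I_m}) : #|injs R| = #|R| ^_ n.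
Proof. by rewrite card_inj_ffuns_on card_ord. Qed.

Lemma hom_quasi_complete : 0 < n ->
  hom (complete n) (@quasi_complete m u v) =
  n`! * 'C(m - 2, n - 1) * 2 + 'C(m - 2, n) * n`!.
Proof.
move=> n_gt0; have m_gt1 : 1 < m.
  by have := max_card [set u; v]; rewrite cards2 uv card_ord.
have := cardsUI (injs [set~ u]) (injs [set~ v]).
rewrite -homs_quasi_complete injs_setI !card_injs !cardsC1 (cardsCs (~: _)) setCK.
rewrite cards2 uv card_ord /hom -/homs => /(canRL (addnK _)) ->.
(* Writing [n = k.+1] and [m = p.+2] makes every truncated subtraction on the indices exact and lets
   Pascal's rule [binS] split ['C(p.+1, k.+1)]. *)
case: n n_gt0 => // k _; case: m m_gt1 => [|[|p]] // _.
rewrite !subSS !subn0 /= -!bin_ffact binS.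
by rewrite mulnDl [_`! * _]mulnC; lia.
Qed.

Lemma hom_quasi_complete_inj :
  hom (complete n) (@quasi_complete m u v) =
  inj (complete n) (@quasi_complete m u v).
Proof.
apply: eq_card => f; rewrite !inE is_hom_quasi_complete.
by rewrite andbAC andbb.
Qed.

(** A surjection would hit both endpoints of the removed edge. *)
Lemma hom_quasi_complete_not_surjective (f : {ffun 'I_n -> 'I_m}) :
  @is_hom (complete n) (@quasi_complete m u v) f ->
  ~~ @surjectiveb (complete n) (@quasi_complete m u v) f.
Proof.
rewrite is_hom_quasi_complete -negb_and => /andP[_]; apply: contra => surf.
have codomE x : x \in codom f.
  by have /existsP[i /eqP <-] := forallP surf x; apply: codom_f.
by rewrite !codomE.
Qed.

Lemma sur_quasi_complete : sur (complete n) (@quasi_complete m u v) = 0.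
Proof.
apply: eq_card0 => f; rewrite !inE; apply/negP => /andP[homf].
exact/negP/hom_quasi_complete_not_surjective.
Qed.

Lemma bij_quasi_complete : bij (complete n) (@quasi_complete m u v) = 0.
Proof.
apply: eq_card0 => f; rewrite !inE; apply/negP => /and3P[homf _].
exact/negP/hom_quasi_complete_not_surjective.
Qed.

End HomCompleteQuasiComplete.

Theorem proposition1 (n m : nat) (hn : 3 <= n) (hm : 3 <= m)
    (u v : complete m) (huv : edge u v) :
  (n >= m -> hom (complete n) (quasi_complete u v) = 0) /\
  (n = m - 1 -> hom (complete n) (quasi_complete u v) = (m - 1)`! * 2) /\
  (n <= m - 2 ->
     hom (complete n) (quasi_complete u v)
     = n`! * 'C(m - 2, n - 1) * 2 + 'C(m - 2, n) * n`!) /\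
  (n <= m - 1 ->
     hom (complete n) (quasi_complete u v)
     = inj (complete n) (quasi_complete u v) /\
     sur (complete n) (quasi_complete u v) = 0 /\
     bij (complete n) (quasi_complete u v) = 0).
Proof.
(* In the complete graph [huv] unfolds to [u != v]. The resulting formula serves all three ranges of
   [n]. *)
have homE := @hom_quasi_complete n m u v huv (ltnW (ltnW hn)).
split=> [le_mn|]; last split=> [def_n|]; last split=> // _.
(* Here [m - 2 < n - 1], so both binomials vanish. *)
- rewrite homE !bin_small ?muln0 //; lia.
- have -> : (m - 1)`! = n`! by rewrite def_n.
  (* The first binomial becomes ['C(m - 2, m - 2)], which is 1, and the second vanishes because
     [m - 2 < n]. *)
  have def_n1 : n - 1 = m - 2 by lia.
  by rewrite homE def_n1 binn bin_small ?muln1 ?addn0 //; lia.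
- split; first exact: hom_quasi_complete_inj.
  by split; [apply: sur_quasi_complete | apply: bij_quasi_complete].
Qed.
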